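(* Let $d\in\mathbb{N}$, $M\in(0,\infty)$, and let $O_i=(W_i,\tilde T_i,\Delta_i)\in[0,1]^{d-1}\times[0,1]\times\{0,1\}$, $i=1,\dots,n$, be right-censored data, with $X_i=(W_i,\tilde T_i)\in[0,1]^d$. Let $f_{\beta,n}$ be the data-dependent model $$f_{\beta,n}(\mathbf{x})=\beta_0+\sum_{s\in\mathcal{S}}\sum_{i=1}^n\beta^s_i\,\mathbf{1}\{X_{s,i}\preceq\mathbf{x}_s\},\qquad \beta\in\mathbb{R}^{n(2^d-1)+1},$$ and let $$L^{\mathrm{pl}}(f,O)=\int_0^{\tilde T}e^{f(u,W)}\,du-\Delta f(\tilde T,W).$$ The problem $$\min_{\|\beta\|_1\le M}\mathbb{P}_n[L^{\mathrm{pl}}(f_{\beta,n},\cdot)]$$ is convex and has a solution. For any solution $\hat\beta$, $f_{\hat\beta,n}$ is a HAL estimator, i.e., $$f_{\hat\beta,n}\in\arg\min_{f\in\mathcal{D}^d_{M,n}}\mathbb{P}_n[L^{\mathrm{pl}}(f,\cdot)].$$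
   Context: $\mathcal{S}$ is the collection of non-empty subsets of $\{1,\dots,d\}$. For $\mathbf{x}\in[0,1]^d$ and $s\in\mathcal{S}$, $\mathbf{x}_s\in[0,1]^{|s|}$ is the tuple of coordinates of $\mathbf{x}$ with index in $s$ in increasing order, $X_{s,i}=(X_i)_s$, and $\preceq$ is the componentwise order. The parameter is $\beta=(\beta_0,(\beta_i^s)_{s\in\mathcal{S},1\le i\le n})$, $\|\beta\|_1=|\beta_0|+\sum_{s}\sum_i|\beta_i^s|$, and $\mathcal{D}^d_{M,n}=\{f_{\beta,n}:\beta\in\mathbb{R}^{n(2^d-1)+1},\ \|\beta\|_1\le M\}$. For a function $f$ on $[0,1]^d$, $f(t,\mathbf{w})$ means the value of $f$ at the point with time coordinate $t$ and covariate coordinates $\mathbf{w}$ (the time coordinate corresponding to $\tilde T$ and the covariate coordinates to $W$ in $X$). $\mathbb{P}_n[h]=\frac1n\sum_{i=1}^n h(O_i)$. ''Convex problem'' means minimization of a convex function of $\beta$ over a convex set. *)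

(* Defs.v *)
From HB Require Import structures.
From mathcomp Require Import all_boot all_order all_algebra.
From mathcomp Require Import all_classical all_reals all_analysis.

Set Implicit Arguments.
Unset Strict Implicit.
Unset Printing Implicit Defensive.

Import Order.TTheory GRing.Theory Num.Theory.
Import numFieldNormedType.Exports.

Local Open Scope classical_set_scope.
Local Open Scope ring_scope.

Definition argmin (R : realType) (T : Type) (A : set T) (F : T -> R) : set T :=
  [set a | A a /\ forall b, A b -> F a <= F b].

Definition unit_cube (R : realType) (d : nat) : set 'rV[R]_d :=
  [set x | forall j, 0 <= x 0 j <= 1].

Definition coord_set (d : nat) : finType := {s : {set 'I_d} | s != finset.set0}.

(* enum_val lists the elements of s in increasing order *)
Definition subvec (R : realType) (d : nat) (s : {set 'I_d}) (x : 'rV[R]_d) :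
  'rV[R]_#|s| := \row_(k < #|s|) x 0 (enum_val k).

Definition vle (R : realType) (m : nat) (u v : 'rV[R]_m) : bool :=
  [forall k, u 0 k <= v 0 k].

(* The pair (beta_0, (beta_i^s)_{s,i}). R^o is R seen as a module over itself,
   which makes this product an lmodType R, of dimension n (2^d - 1) + 1. *)
Definition param (R : realType) (d n : nat) : lmodType R :=
  (R^o * {ffun coord_set d * 'I_n -> R^o})%type.

Definition norm1 (R : realType) (d n : nat) (beta : param R d n) : R :=
  `|beta.1| + \sum_(s : coord_set d) \sum_(i < n) `|beta.2 (s, i)|.

(* A function on [0,1]^d is represented by its extension by a default value
   outside the cube, so that equality of representatives is equality on the
   cube. *)
Definition hal_model (R : realType) (d n : nat) (X : 'I_n -> 'rV[R]_d)
    (beta : param R d n) : 'rV[R]_d -> R :=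
  (fun x => beta.1 + \sum_(s : coord_set d) \sum_(i < n)
     beta.2 (s, i) * (vle (subvec (val s) (X i)) (subvec (val s) x))%:R)
  \_ (@unit_cube R d).

Definition l1_ball (R : realType) (d n : nat) (M : R) : set (param R d n) :=
  [set beta | norm1 beta <= M].

Definition hal_class (R : realType) (d n : nat) (X : 'I_n -> 'rV[R]_d) (M : R) :
  set ('rV[R]_d -> R) := hal_model X @` @l1_ball R d n M.

(* p is the number of covariates, so that d = p + 1. *)
Record observation (R : realType) (p : nat) := Observation {
  covariates : 'rV[R]_p ;
  follow_up : R ;
  event : bool
}.

Definition obs_space (R : realType) (p : nat) : set (observation R p) :=
  [set o | @unit_cube R p (covariates o) /\ 0 <= follow_up o <= 1].

Definition time_point (R : realType) (p : nat) (w : 'rV[R]_p) (t : R) :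
  'rV[R]_(p + 1) := row_mx w (const_mx t).

Definition obs_point (R : realType) (p : nat) (o : observation R p) :
  'rV[R]_(p + 1) := time_point (covariates o) (follow_up o).

(* The members of hal_class are bounded Borel functions on the cube, hence the
   real-valued integral is the genuine one for them. *)
Definition loss_pl (R : realType) (p : nat) (f : 'rV[R]_(p + 1) -> R)
    (o : observation R p) : R :=
  \int[@lebesgue_measure R]_(u in `[0, follow_up o])
      expR (f (time_point (covariates o) u))
  - (event o)%:R * f (obs_point o).

Definition emp_mean (R : realType) (p n : nat) (O : 'I_n -> observation R p)
    (h : observation R p -> R) : R :=
  n%:R^-1 * \sum_(i < n) h (O i).

(* Main.v *)
(* For a fixed point x the value f_beta(x) is linear in beta and bounded by
   |beta|_1. Convexity of the risk thus follows from convexity of exp under the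
   integral. The same two facts, with e^x - e^y <= e^x (x - y), make the risk
   locally Lipschitz in beta for the l1 norm; as the l1 ball is compact, a
   minimizer exists. The class D is by definition the image of the ball, so
   minimizing over beta is minimizing over D. *)
Require Import Defs.
From HB Require Import structures.
From mathcomp Require Import all_boot all_order all_algebra.
From mathcomp Require Import all_classical all_reals all_analysis.
From mathcomp Require Import measurable_realfun ring lra.

Set Implicit Arguments.
Unset Strict Implicit.
Unset Printing Implicit Defensive.

Import Order.TTheory GRing.Theory Num.Theory.
Import numFieldNormedType.Exports.

Local Open Scope classical_set_scope.
Local Open Scope ring_scope.

(** * The l1 norm of a parameter *)

Section Norm1.
Variables (R : realType) (d n : nat).
Implicit Types a b : param R d n.

Lemma norm1_ge0 a : 0 <= norm1 a.
Proof. by rewrite addr_ge0 ?sumr_ge0// => s _; rewrite sumr_ge0. Qed.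

Lemma norm1Z k a : norm1 (k *: a) = `|k| * norm1 a.
Proof.
rewrite /norm1 mulrDr /= normrM mulr_sumr; congr (_ + _).
by apply: eq_bigr => s _; rewrite mulr_sumr; apply: eq_bigr => i _;
  rewrite ffunE normrM.
Qed.

Lemma norm1_0 : norm1 (0 : param R d n) = 0.
Proof. by rewrite -(scale0r 0) norm1Z normr0 mul0r. Qed.

Lemma norm1N a : norm1 (- a) = norm1 a.
Proof.
rewrite /norm1 normrN; congr (_ + _).
by apply: eq_bigr => s _; apply: eq_bigr => i _; rewrite ffunE normrN.
Qed.

Lemma norm1D a b : norm1 (a + b) <= norm1 a + norm1 b.
Proof.
rewrite /norm1 addrACA -big_split /= lerD ?ler_normD// ler_sum// => s _.
by rewrite -big_split ler_sum// => i _; rewrite ffunE ler_normD.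
Qed.

Lemma norm1_ge_intercept a : `|a.1| <= norm1 a.
Proof. by rewrite lerDl sumr_ge0// => s _; rewrite sumr_ge0. Qed.

Lemma norm1_ge_coef a s i : `|a.2 (s, i)| <= norm1 a.
Proof.
rewrite /norm1 (bigD1 s)//= (bigD1 i)//= -!addrA ler_wpDl// lerDl.
by rewrite addr_ge0 ?sumr_ge0// => s' _; rewrite sumr_ge0.
Qed.

End Norm1.

(** * Linearity and boundedness of the model in the parameter *)

Section Model.
Variables (R : realType) (d n : nat) (X : 'I_n -> 'rV[R]_d).
Implicit Types (a b : param R d n) (x : 'rV[R]_d).

Lemma hal_modelE a x : unit_cube x ->
  hal_model X a x = a.1 + \sum_(s : coord_set d) \sum_(i < n)
     a.2 (s, i) * (vle (subvec (val s) (X i)) (subvec (val s) x))%:R.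
Proof. by move=> ux; rewrite /hal_model patchT// inE. Qed.

Lemma hal_model_linear k a b x :
  hal_model X (k *: a + b) x = k * hal_model X a x + hal_model X b x.
Proof.
(* Outside the cube both sides are the default value 0. *)
rewrite /hal_model !patchE; case: ifP => _; last by rewrite mulr0 addr0.
rewrite mulrDr addrACA mulr_sumr -big_split; congr (_ + _).
apply: eq_bigr => s _; rewrite mulr_sumr -big_split.
by apply: eq_bigr => i _; rewrite !ffunE mulrDl mulrA.
Qed.

Lemma hal_modelB a b x :
  hal_model X (a - b) x = hal_model X a x - hal_model X b x.
Proof. by rewrite addrC -scaleN1r hal_model_linear mulN1r addrC. Qed.

Lemma hal_modelZ k a x : hal_model X (k *: a) x = k * hal_model X a x.
Proof.
(* The model at the zero parameter vanishes: writing 0 as 0 - 0 makes it a difference of equal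
   terms. *)
rewrite -[k *: a]addr0 hal_model_linear -[in X in _ + X](subrr 0) hal_modelB.
by rewrite subrr addr0.
Qed.

(** Every indicator is 0 or 1, so the triangle inequality suffices. Combined with [hal_modelB], this
    also bounds the difference of two models uniformly in the point. *)
Lemma hal_model_bound a x : `|hal_model X a x| <= norm1 a.
Proof.
rewrite /hal_model patchE; case: ifP => _; last by rewrite normr0 norm1_ge0.
rewrite (le_trans (ler_normD _ _))// lerD2l (le_trans (ler_norm_sum _ _ _))//.
rewrite ler_sum// => s _; rewrite (le_trans (ler_norm_sum _ _ _))// ler_sum//.
by move=> i _; rewrite normrM ler_piMr// normr_nat lern1 leq_b1.
Qed.

End Model.

(** * Integrability, convexity and local Lipschitz bound of the loss *)

Lemma unit_cube_time_point (R : realType) (p : nat) (w : 'rV[R]_p) (t : R) :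
  unit_cube w -> 0 <= t <= 1 -> unit_cube (time_point w t).
Proof.
by move=> uw t01 j; rewrite mxE; case: fintype.split => k; rewrite ?mxE.
Qed.

(** Only the last coordinate of [time_point] moves with time. Each indicator is thus monotone in
    time, hence measurable. *)
Lemma vle_time_point_homo (R : realType) (p : nat) (s : {set 'I_(p + 1)})
    (x : 'rV[R]_(p + 1)) (w : 'rV[R]_p) (u v : R) : u <= v ->
  vle (subvec s x) (subvec s (time_point w u)) ->
  vle (subvec s x) (subvec s (time_point w v)).
Proof.
move=> uv /forallP xu; apply/forallP => k; apply: le_trans (xu k) _.
by rewrite !mxE; case: fintype.split => j; rewrite ?mxE.
Qed.

Section Loss.
Variables (R : realType) (p n : nat) (X : 'I_n -> 'rV[R]_(p + 1)).
Implicit Types (a b : param R (p + 1) n) (o : observation R p) (t : R).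

Local Notation mu := (@lebesgue_measure R).

Lemma measurable_hal_model a (w : 'rV[R]_p) t : unit_cube w -> t <= 1 ->
  measurable_fun `[0, t] (fun u => hal_model X a (time_point w u)).
Proof.
(* [g] drops the cutoff outside the cube; since t <= 1, it agrees with the model on the interval. *)
move=> uw t1; pose g u := a.1 + \sum_(s : coord_set (p + 1)) \sum_(i < n)
  a.2 (s, i) * (vle (subvec (val s) (X i))
                    (subvec (val s) (time_point w u)))%:R.
apply: (@eq_measurable_fun _ _ _ _ _ g) => [u|].
  rewrite inE /= in_itv /= => /andP[u0 ut].
  rewrite hal_modelE//; apply: unit_cube_time_point => //.
  by rewrite u0 (le_trans ut).
apply: measurable_funD; first exact: measurable_cst.
apply: measurable_sum => s; apply: measurable_sum => i.
apply: measurable_funM; first exact: measurable_cst.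
apply: nondecreasing_measurable => // u v uv.
rewrite ler_nat; case vle_u: (vle _ (subvec _ (time_point w u))) => //.
by rewrite (vle_time_point_homo uv vle_u).
Qed.

Lemma itv_lebesgue_lty t : (mu `[0%R, t] < +oo)%E.
Proof.
by rewrite lebesgue_measure_itv; case: ifP => //; rewrite -EFinB ltry.
Qed.

Lemma integrable_expR_hal_model a o : obs_space o ->
  mu.-integrable `[0, follow_up o]
    (EFin \o (fun u => expR (hal_model X a (time_point (covariates o) u)))).
Proof.
move=> [uw /andP[t0 t1]]; apply: measurable_bounded_integrable => //.
- exact: itv_lebesgue_lty.
- apply: measurableT_comp; first exact: measurable_expR.
  exact: measurable_hal_model.
- exists (expR (norm1 a)); split; first exact: num_real.
  move=> y ay u _ /=; rewrite (le_trans _ (ltW ay))// ger0_norm ?expR_ge0//.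
  by rewrite ler_expR (le_trans (ler_norm _))// hal_model_bound.
Qed.

Lemma convex_loss_pl (t : {i01 R}) a b o : obs_space o ->
  loss_pl (hal_model X (t%:num *: a + (1 - t%:num) *: b)) o <=
  t%:num * loss_pl (hal_model X a) o
    + (1 - t%:num) * loss_pl (hal_model X b) o.
Proof.
move=> oo; set k := t%:num; set c := k *: a + _.
have cE x : hal_model X c x = k * hal_model X a x + (1 - k) * hal_model X b x.
  by rewrite hal_model_linear hal_modelZ.
rewrite /loss_pl cE.
have ia := integrable_expR_hal_model a oo.
have ib := integrable_expR_hal_model b oo.
have ic := integrable_expR_hal_model c oo.
set Ic := (X in X - _ <= _).
set Ia := (X in _ <= k * (X - _) + _).
set Ib := (X in _ <= _ + _ * (X - _)).
(* The event terms on the two sides are equal by linearity in the parameter, so only the integrals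
   have to be compared. *)
suff : Ic <= k * Ia + (1 - k) * Ib.
  by set fa := hal_model X a _; set fb := hal_model X b _; set e := _%:R; nra.
rewrite -!RintegralZl// -RintegralD//.
apply: le_Rintegral => //; first last.
- by move=> u _; rewrite cE; exact: convex_expR.
- by apply: eq_integrable (integrableD _ (integrableZl _ k ia)
                                         (integrableZl _ (1 - k) ib)).
- exact: (integrableZl _ k ia).
- exact: (integrableZl _ (1 - k) ib).
Qed.

(** The graph of exp lies above its tangent at x: multiply 1 + (y - x) <= e^(y - x) by e^x. *)
Lemma expR_sub_le (x y : R) : expR x - expR y <= expR x * (x - y).
Proof.
have := expR_ge1Dx (y - x); rewrite expRD expRN.
rewrite -(ler_pM2l (expR_gt0 x)) mulrCA divff ?gt_eqF ?expR_gt0// mulr1; nra.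
Qed.

(** The exponential factor comes from the integral and the summand 1 from the event term. Only the
    norm of [a] enters, because the tangent in [expR_sub_le] is taken at the first argument. *)
Lemma loss_pl_sub_le a b o : obs_space o ->
  loss_pl (hal_model X a) o - loss_pl (hal_model X b) o <=
  (expR (norm1 a) + 1) * norm1 (a - b).
Proof.
move=> oo; have [_ /andP[t0 t1]] := oo.
have ia := integrable_expR_hal_model a oo.
have ib := integrable_expR_hal_model b oo.
have abE x : `|hal_model X a x - hal_model X b x| <= norm1 (a - b).
  by rewrite -hal_modelB hal_model_bound.
set C := expR (norm1 a) * norm1 (a - b).
have C0 : 0 <= C by rewrite mulr_ge0 ?expR_ge0 ?norm1_ge0.
have decomp (x y e u v : R) : x - e * u - (y - e * v) = x - y + e * (v - u).
  by ring.
rewrite /loss_pl decomp mulrDl mul1r -RintegralB// lerD//.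
  apply: (@le_trans _ _ (\int[mu]_(u in `[0, follow_up o]) C)).
    apply: le_Rintegral => //.
    - exact: eq_integrable (integrableB _ ia ib).
    - apply: measurable_bounded_integrable => //.
        exact: itv_lebesgue_lty.
      exact: bounded_cst.
    move=> u _; apply: le_trans (expR_sub_le _ _) _.
    apply: (@le_trans _ _ (expR (hal_model X a (time_point (covariates o) u)) *
                           norm1 (a - b))).
      by rewrite ler_pM2l ?expR_gt0// (le_trans (ler_norm _)).
    rewrite ler_wpM2r ?norm1_ge0// ler_expR.
    by rewrite (le_trans (ler_norm _))// hal_model_bound.
  rewrite Rintegral_cst// ler_piMr//.
  (* Follow-up times are at most 1, so integrating the constant [C] gives at most [C]. *)
  have mu_le1 : (mu `[0%R, follow_up o] <= 1)%E.
    rewrite lebesgue_measure_itv /=; case: ifP; rewrite ?lee01//;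
      by rewrite sube0 lee_fin.
  rewrite -[leRHS]/(fine 1%E) fine_le// ge0_fin_numE//.
  by rewrite (le_lt_trans mu_le1)// ltry.
rewrite (le_trans (ler_norm _))// normrM distrC.
rewrite (le_trans _ (abE (obs_point o)))//.
by rewrite ler_piMl// normr_nat lern1 leq_b1.
Qed.

End Loss.

(** Near v the factor C w + C v stays close to 2 C v while D w v tends to 0, so the product squeezes
    the increment of f. [D] is kept abstract because it will be the l1 norm of a difference, whereas
    row vectors carry the sup norm. *)
Lemma continuous_dist_le (R : realType) (T : topologicalType) (f C : T -> R)
    (D : T -> T -> R) : continuous C -> (forall v, D w v @[w --> v] --> 0) ->
  (forall w v, `|f w - f v| <= (C w + C v) * D w v) -> continuous f.
Proof.
move=> cC D0 fD v.
suff dist0 : `|f w - f v| @[w --> v] --> (0 : R).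
  by apply/subr_cvg0; exact: norm_cvg0 dist0.
apply: (@squeeze_cvgr _ (nbhs v) _ R (cst 0) (fun w => (C w + C v) * D w v)).
- by near=> w; rewrite normr_ge0 fD.
- exact: cvg_cst.
- rewrite -[X in _ --> X](mulr0 (C v + C v)); apply: cvgM; last exact: D0.
  by apply: cvgD; [exact: cC|exact: cvg_cst].
Unshelve. all: by end_near.
Qed.

(** * Convexity and local Lipschitz bound of the empirical risk *)

Section Objective.
Variables (R : realType) (p n : nat) (X : 'I_n -> 'rV[R]_(p + 1)).
Variable O : 'I_n -> observation R p.
Hypotheses (n_gt0 : (0 < n)%N) (O_in : forall i, obs_space (O i)).

Let objective (a : param R (p + 1) n) := emp_mean O (loss_pl (hal_model X a)).

Lemma convex_objective :
  convex_function (E := param R (p + 1) n) setT objective.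
Proof.
move=> t a b _ _; rewrite convRE /objective /emp_mean.
rewrite !(mulrCA _ n%:R^-1) -mulrDr ler_wpM2l ?invr_ge0// !mulr_sumr.
by rewrite -big_split ler_sum// => i _; exact: convex_loss_pl.
Qed.

Lemma objective_sub_le a b :
  objective a - objective b <= (expR (norm1 a) + 1) * norm1 (a - b).
Proof.
rewrite /objective /emp_mean -mulrBr -sumrB.
(* The bound becomes a sum of n equal terms, to be compared term by term. *)
rewrite ler_pdivrMl ?ltr0n// mulr_natl -[leRHS]/(_ *+ n).
rewrite -[X in _ *+ X]card_ord -sumr_const ler_sum// => i _.
exact: loss_pl_sub_le.
Qed.

(** The one-sided bound is used in both orders; the sum of the two constants dominates each of
    them. *)
Lemma dist_objective_le a b : `|objective a - objective b| <=
  ((expR (norm1 a) + 1) + (expR (norm1 b) + 1)) * norm1 (a - b).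
Proof.
have N0 := norm1_ge0 (a - b).
have Na := expR_ge0 (norm1 a); have Nb := expR_ge0 (norm1 b).
have Hab := objective_sub_le a b; have := objective_sub_le b a.
have -> : norm1 (b - a) = norm1 (a - b).
  by rewrite -opprB norm1N.
by rewrite ler_norml => Hba; apply/andP; split; nra.
Qed.

End Objective.

(* [param] carries no topology, so compactness is argued on row vectors. *)
Section Coordinates.
Variables (R : realType) (d n : nat).

Let idx : finType := option (coord_set d * 'I_n).
Implicit Types v w : 'rV[R]_#|{: idx}|.

Definition param_of_row (v : 'rV[R]_#|{: idx}|) : param R d n :=
  (v 0 (enum_rank None), [ffun q => v 0 (enum_rank (Some q))]).

Definition row_of_param (a : param R d n) : 'rV[R]_#|{: idx}| :=
  \row_j if enum_val j is Some q then a.2 q else a.1.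

Lemma row_of_paramK : cancel row_of_param param_of_row.
Proof.
case=> a0 a; congr pair; first by rewrite mxE enum_rankK.
by apply/ffunP => q; rewrite ffunE mxE enum_rankK.
Qed.

Lemma param_of_rowB v w :
  param_of_row (v - w) = param_of_row v - param_of_row w.
Proof.
by congr pair; [rewrite !mxE|apply/ffunP => q; rewrite !ffunE !mxE].
Qed.

(** This compares the sup norm with the l1 norm and makes the l1 ball bounded. *)
Lemma coord_le_norm1 v j : `|v 0 j| <= norm1 (param_of_row v).
Proof.
rewrite -[j]enum_valK; case: (enum_val j) => [[s i]|].
  by have := norm1_ge_coef (param_of_row v) s i; rewrite ffunE.
exact: norm1_ge_intercept (param_of_row v).
Qed.

Lemma norm1_param_of_row v : norm1 (param_of_row v) =
  `|v 0 (enum_rank None)| +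
  \sum_(s : coord_set d) \sum_(i < n) `|v 0 (enum_rank (Some (s, i)))|.
Proof.
by congr (_ + _); apply: eq_bigr => s _; apply: eq_bigr => i _; rewrite ffunE.
Qed.

Lemma continuous_norm1 : continuous (@norm1 R d n \o param_of_row).
Proof.
have -> : @norm1 R d n \o param_of_row = fun v => `|v 0 (enum_rank None)| +
    \sum_(s : coord_set d) \sum_(i < n) `|v 0 (enum_rank (Some (s, i)))|.
  by apply/funext => v; exact: norm1_param_of_row.
have coordC j : continuous (fun v => `|v 0 j|).
  by move=> v; exact: (cvg_norm (@coord_continuous R _ _ 0 j v)).
move=> v; apply: (@cvgD _ _ _ (nbhs v)); first exact: coordC.
apply: (@cvg_big _ _ _ _ _ _ _ (nbhs v)) => [|s _].
  exact: add_continuous.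
apply: (@cvg_big _ _ _ _ _ _ _ (nbhs v)) => [|i _].
  exact: add_continuous.
exact: coordC.
Qed.

Lemma norm1_sub_cvg0 v : norm1 (param_of_row (w - v)) @[w --> v] --> (0 : R).
Proof.
(* With the limit 0 written as the value at w = v, the claim is continuity of a composite at v. *)
rewrite -(norm1_0 R d n) -(subrr (param_of_row v)) -param_of_rowB.
have sub_cont : continuous (fun w => w - v).
  by move=> u; apply: (@cvgB _ _ _ (nbhs u)); [exact: cvg_id|exact: cvg_cst].
exact: (continuous_comp (sub_cont v) (@continuous_norm1 _)).
Qed.

(** Heine-Borel: the ball is closed as the preimage of a closed half-line under a continuous map,
    and bounded in sup norm. *)
Lemma compact_l1_ball (M : R) : compact (param_of_row @^-1` l1_ball M).
Proof.
apply: bounded_closed_compact; last first.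
  exact: (continuous_closedP _).1 continuous_norm1 _ (@closed_le R M).
exists M; split; first exact: num_real.
move=> x Mx v /= vM; rewrite (le_trans _ (ltW Mx))//.
rewrite -[`|v|]/(mx_norm v).
(* A nonzero sup norm is attained at some entry. If it is 0, then 0 <= M follows from v lying in the
   ball. *)
have [->|/mx_norm_neq0[[i j] ->]] := eqVneq (mx_norm v) 0.
  exact: le_trans (norm1_ge0 _) vM.
by rewrite ord1 (le_trans (coord_le_norm1 _ _) vM).
Qed.

End Coordinates.

(** * Convexity of the ball and existence of a minimizer *)

Lemma convex_l1_ball (R : realType) (d n : nat) (M : R) :
  convex_set (M := param R d n) (@l1_ball R d n M).
Proof.
move=> a b t; rewrite !inE /l1_ball /= => aM bM.
(* The abstract convex combination unfolds to module operations, where the triangle inequality and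
   homogeneity apply. *)
rewrite -[norm1 _]/(norm1 (t%:num *: (a : param R d n) + (1 - t%:num) *: b)).
have t0 : 0 <= t%:num by [].
have t1 : 0 <= 1 - t%:num by rewrite subr_ge0.
by apply: le_trans (norm1D _ _) _; rewrite !norm1Z !ger0_norm//; nra.
Qed.

Theorem proposition11 (R : realType) (p n : nat) (n_gt0 : (0 < n)%N)
    (M : R) (M_gt0 : 0 < M) (O : 'I_n -> observation R p)
    (O_in : forall i, @obs_space R p (O i)) :
  let X := fun i => obs_point (O i) in
  let risk := fun f : 'rV[R]_(p + 1) -> R => emp_mean O (loss_pl f) in
  let objective := fun beta : param R (p + 1) n => risk (hal_model X beta) in
  let feasible := @l1_ball R (p + 1) n M in
  [/\ convex_set (M := param R (p + 1) n) feasible,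
      convex_function (E := param R (p + 1) n) setT objective,
      argmin feasible objective !=set0
    & forall beta, argmin feasible objective beta ->
        argmin (hal_class X M) risk (hal_model X beta)].
Proof.
move=> X risk objective feasible; split.
- exact: convex_l1_ball.
- exact: convex_objective.
- pose obj := objective \o @param_of_row R (p + 1) n.
  have cont_obj : continuous obj.
    apply: (@continuous_dist_le _ _ _
      (fun v => expR (norm1 (param_of_row v : param R (p + 1) n)) + 1)
      (fun w v => norm1 (param_of_row (w - v) : param R (p + 1) n))).
    + move=> v; apply: (@cvgD _ _ _ (nbhs v)); last exact: cvg_cst.
      exact: continuous_comp (@continuous_norm1 R (p + 1) n v)
        (@continuous_expR R _).
    + exact: norm1_sub_cvg0.
    + by move=> w v; rewrite param_of_rowB; exact: dist_objective_le.
  (* The zero parameter is feasible because M is positive. *)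
  have ball0 : (@param_of_row R (p + 1) n @^-1` l1_ball M) !=set0.
    exists (row_of_param 0); rewrite /= row_of_paramK /l1_ball /= norm1_0.
    exact: ltW.
  have [v vM vmin] := EVT_min_rV ball0 (@compact_l1_ball _ _ _ M)
                        (continuous_subspaceT cont_obj).
  exists (param_of_row v); split=> [|b bM]; first by rewrite inE in vM.
  (* Every parameter comes from a row, so the minimum over rows is the minimum over the ball. *)
  rewrite -[b]row_of_paramK.
  by apply: (vmin (row_of_param b)); rewrite inE /= row_of_paramK.
- move=> beta [betaM min]; split; first by exists beta.
  by move=> _ [b bM <-]; exact: min.
Qed.
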